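(* For $n\in\omega$ let $\mathcal V_n=\mathsf{HSP}(\mathbf J_n)$ be the variety generated by $\mathbf J_n$. (1) Up to isomorphism, the only subdirectly irreducible algebra in $\mathcal V_0$ is $\mathbf J_0$ itself. (2) Let $n\in\omega\setminus\{0\}$. Up to isomorphism, $\mathcal V_n$ contains $n+1$ subdirectly irreducible algebras: the four-element algebra $\mathbf J_{0,n}$ and the six-element algebras $\mathbf J_{1,n,k}$, for $k\in\{1,\dots,n\}$. Moreover, for all $n\in\omega$: (3) The algebras $\mathbf J_{0,n}$ and $\mathbf J_{1,n,k}$, for $k\in\{1,\dots,n\}$, are injective in $\mathcal V_n$. (4) Every algebra in $\mathcal V_n$ embeds into an injective algebra in $\mathcal V_n$. (5) $\mathcal V_n$ has the congruence extension property and the amalgamation property.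
   Context: **The algebra $\mathbf J_n$.** $J_n=\{\top,\bot,f_0,\dots,f_n,t_0,\dots,t_n\}$ ($2n+4$ distinct elements). Knowledge order $\leqslant_k$: $\bot$ is least, $\top$ is greatest, $f_n<_k\cdots<_k f_0$, $t_n<_k\cdots<_k t_0$, each $f_i$ incomparable to each $t_j$. Truth order $\leqslant_t$: $f_0<_t\cdots<_t f_n<_t x<_t t_n<_t\cdots<_t t_0$ for both $x\in\{\top,\bot\}$, with $\top,\bot$ incomparable. $\otimes,\oplus$ are meet and join for $\leqslant_k$, $\wedge,\vee$ are meet and join for $\leqslant_t$; $\neg\top=\top$, $\neg\bot=\bot$, $\neg f_m=t_m$, $\neg t_m=f_m$. $\mathbf J_n=\langle J_n;\otimes,\oplus,\wedge,\vee,\neg,\top,f_0,\dots,f_n,t_0,\dots,t_n,\bot\rangle$, every element being named by a constant. **$\mathbf J_{0,n}$** is the algebra in the signature of $\mathbf J_n$ whose universe, operations $\otimes,\oplus,\wedge,\vee,\neg$ and constants $\top,\bot$ are those of $\mathbf J_0$, with all constants $f_0,\dots,f_n$ taking the value $f_0$ and all constants $t_0,\dots,t_n$ taking the value $t_0$ (so $\mathbf J_{0,0}=\mathbf J_0$). **$\mathbf J_{1,n,k}$** ($n\geqslant1$, $1\leqslant k\leqslant n$) is the algebra in the signature of $\mathbf J_n$ with universe $\{\top,\mathbf 0,f,\mathbf 1,t,\bot\}$ whose operations $\otimes,\oplus,\wedge,\vee,\neg$ and constants $\top,\bot$ are those of $\mathbf J_1$ with $f_0,f_1,t_0,t_1$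 renamed $\mathbf 0,f,\mathbf 1,t$ respectively; the constants $f_0,\dots,f_{k-1}$ take the value $\mathbf 0$, $f_k,\dots,f_n$ the value $f$, $t_0,\dots,t_{k-1}$ the value $\mathbf 1$, and $t_k,\dots,t_n$ the value $t$. An algebra $\mathbf C\in\mathcal V_n$ is injective in $\mathcal V_n$ if for every embedding $\mathbf A\to\mathbf B$ in $\mathcal V_n$, each homomorphism $\mathbf A\to\mathbf C$ extends to a homomorphism $\mathbf B\to\mathbf C$. *)

(* Defs.v *)
From mathcomp Require Import all_boot all_order.

Set Implicit Arguments.
Unset Strict Implicit.
Unset Printing Implicit Defensive.

(** * The set [J_n] with its two orders *)

Inductive J (n : nat) : Type :=
  | Jtop | Jbot | Jf of 'I_n.+1 | Jt of 'I_n.+1.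

Arguments Jtop {n}.
Arguments Jbot {n}.

(* In both orders the indices run as in the chains
   f_n <k ... <k f_0,  t_n <k ... <k t_0,
   f_0 <t ... <t f_n <t {top, bot} <t t_n <t ... <t t_0. *)
Definition leK n (x y : J n) : bool :=
  match x, y with
  | Jbot, _ => true
  | _, Jtop => true
  | Jf i, Jf j => j <= i
  | Jt i, Jt j => j <= i
  | _, _ => false
  end.

Definition leT n (x y : J n) : bool :=
  match x, y with
  | Jf i, Jf j => i <= j
  | Jf _, _ => true
  | Jt i, Jt j => j <= i
  | _, Jt _ => true
  | Jtop, Jtop => true
  | Jbot, Jbot => true
  | _, _ => false
  end.

(* The four lattice operations are given by explicit tables; [otimesP],
   [oplusP], [wedgeP] and [veeP] below show that they are the meets and joins
   of the two orders. *)
Definition otimes n (x y : J n) : J n :=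
  match x, y with
  | Jtop, z | z, Jtop => z
  | Jf i, Jf j => Jf (Order.max i j)
  | Jt i, Jt j => Jt (Order.max i j)
  | _, _ => Jbot
  end.

Definition oplus n (x y : J n) : J n :=
  match x, y with
  | Jbot, z | z, Jbot => z
  | Jf i, Jf j => Jf (Order.min i j)
  | Jt i, Jt j => Jt (Order.min i j)
  | _, _ => Jtop
  end.

Definition wedge n (x y : J n) : J n :=
  match x, y with
  | Jf i, Jf j => Jf (Order.min i j)
  | Jf i, _ | _, Jf i => Jf i
  | Jt i, Jt j => Jt (Order.max i j)
  | Jt _, z | z, Jt _ => z
  | Jtop, Jtop => Jtop
  | Jbot, Jbot => Jbot
  | _, _ => Jf ord_max
  end.

Definition vee n (x y : J n) : J n :=
  match x, y with
  | Jt i, Jt j => Jt (Order.min i j)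
  | Jt i, _ | _, Jt i => Jt i
  | Jf i, Jf j => Jf (Order.max i j)
  | Jf _, z | z, Jf _ => z
  | Jtop, Jtop => Jtop
  | Jbot, Jbot => Jbot
  | _, _ => Jt ord_max
  end.

Definition Jneg n (x : J n) : J n :=
  match x with
  | Jtop => Jtop
  | Jbot => Jbot
  | Jf i => Jt i
  | Jt i => Jf i
  end.

Definition is_meet n (le : rel (J n)) (x y z : J n) : Prop :=
  [/\ le z x, le z y & forall w, le w x -> le w y -> le w z].

Definition is_join n (le : rel (J n)) (x y z : J n) : Prop :=
  [/\ le x z, le y z & forall w, le x w -> le y w -> le z w].

Lemma leK_order n :
  [/\ reflexive (@leK n), antisymmetric (@leK n) & transitive (@leK n)].
Proof.
split.
- by case=> [||i|i] /=.
- by case=> [||i|i] [||j|j] //=; rewrite -eqn_leq eq_sym => /eqP/val_inj->.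
- by case=> [||i|i] [||j|j] [||k|k] //= ij jk; apply: leq_trans ij.
Qed.

Lemma leT_order n :
  [/\ reflexive (@leT n), antisymmetric (@leT n) & transitive (@leT n)].
Proof.
split.
- by case=> [||i|i] /=.
- case=> [||i|i] [||j|j] //=; first by rewrite -eqn_leq => /eqP/val_inj->.
  by rewrite -eqn_leq eq_sym => /eqP/val_inj->.
- case=> [||i|i] [||j|j] [||k|k] //= ij jk; first exact: leq_trans jk.
  exact: leq_trans ij.
Qed.

Lemma ord_minmaxE n (i j k : 'I_n.+1) :
  ((k <= Order.min i j) = (k <= i) && (k <= j)) *
  ((Order.min i j <= k) = (i <= k) || (j <= k)) *
  ((k <= Order.max i j) = (k <= i) || (k <= j)) *
  ((Order.max i j <= k) = (i <= k) && (j <= k)).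
Proof.
split; [split; [split|]|].
- exact: Order.TotalTheory.le_min k i j.
- exact: Order.TotalTheory.ge_min k i j.
- exact: Order.TotalTheory.le_max k i j.
- exact: Order.TotalTheory.ge_max k i j.
Qed.

Lemma otimesP n (x y : J n) : is_meet (@leK n) x y (otimes x y).
Proof.
case: x => [||i|i]; case: y => [||j|j]; split; try (case=> [||k|k]).
all: rewrite /= ?ord_minmaxE ?leqnn ?leq_ord ?orbT //.
all: by move=> -> ->.
Qed.

Lemma oplusP n (x y : J n) : is_join (@leK n) x y (oplus x y).
Proof.
case: x => [||i|i]; case: y => [||j|j]; split; try (case=> [||k|k]).
all: rewrite /= ?ord_minmaxE ?leqnn ?leq_ord ?orbT //.
all: by move=> -> ->.
Qed.

Lemma wedgeP n (x y : J n) : is_meet (@leT n) x y (wedge x y).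
Proof.
case: x => [||i|i]; case: y => [||j|j]; split; try (case=> [||k|k]).
all: rewrite /= ?ord_minmaxE ?leqnn ?leq_ord ?orbT //.
all: by move=> -> ->.
Qed.

Lemma veeP n (x y : J n) : is_join (@leT n) x y (vee x y).
Proof.
case: x => [||i|i]; case: y => [||j|j]; split; try (case=> [||k|k]).
all: rewrite /= ?ord_minmaxE ?leqnn ?leq_ord ?orbT //.
all: by move=> -> ->.
Qed.

(** * Algebras in the signature of [J_n] *)

Inductive binop : Type := Otimes | Oplus | Wedge | Vee.

(* Every element of J_n is named by a constant, so [J n] also serves as the set
   of constant symbols. *)
Record algebra (n : nat) : Type := Algebra {
  carrier :> Type;
  bin : binop -> carrier -> carrier -> carrier;
  neg : carrier -> carrier;
  cst : J n -> carrier
}.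

Arguments Algebra {n carrier}.
Arguments bin {n} _ _ _ _.
Arguments neg {n} _ _.
Arguments cst {n} _ _.

Definition is_hom n (A B : algebra n) (h : A -> B) : Prop :=
  [/\ forall o x y, h (bin A o x y) = bin B o (h x) (h y),
      forall x, h (neg A x) = neg B (h x)
    & forall c, h (cst A c) = cst B c].

Definition is_embedding n (A B : algebra n) (h : A -> B) : Prop :=
  is_hom h /\ injective h.

Definition is_iso n (A B : algebra n) (h : A -> B) : Prop :=
  is_hom h /\ bijective h.

Definition isomorphic n (A B : algebra n) : Prop :=
  exists h : A -> B, is_iso h.

Definition surjective (A B : Type) (h : A -> B) : Prop :=
  forall b, exists a, h a = b.

Definition prod_alg n (I : Type) (A : I -> algebra n) : algebra n :=
  Algebra (fun o (x y : forall i, A i) i => bin (A i) o (x i) (y i))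
          (fun x i => neg (A i) (x i))
          (fun c i => cst (A i) c).

Record subuniverse n (A : algebra n) : Type := Subuniverse {
  mem_sub :> A -> Prop;
  sub_bin : forall o x y, mem_sub x -> mem_sub y -> mem_sub (bin A o x y);
  sub_neg : forall x, mem_sub x -> mem_sub (neg A x);
  sub_cst : forall c, mem_sub (cst A c)
}.

Definition sub_alg n (A : algebra n) (S : subuniverse A) : algebra n :=
  Algebra
    (fun o (x y : {a : A | S a}) =>
       exist S _ (sub_bin o (proj2_sig x) (proj2_sig y)))
    (fun x => exist S _ (sub_neg (proj2_sig x)))
    (fun c => exist S _ (sub_cst S c)).

Definition is_congruence n (A : algebra n) (R : A -> A -> Prop) : Prop :=
  [/\ (forall x, R x x),
      (forall x y, R x y -> R y x)
    & (forall x y z, R x y -> R y z -> R x z)] /\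
  (forall o x x' y y', R x x' -> R y y' -> R (bin A o x y) (bin A o x' y')) /\
  (forall x x', R x x' -> R (neg A x) (neg A x')).

(** * Classes of algebras *)

Definition class_P n (K : algebra n -> Prop) (B : algebra n) : Prop :=
  exists (I : Type) (A : I -> algebra n),
    (forall i, K (A i)) /\ isomorphic (prod_alg A) B.

Definition class_S n (K : algebra n -> Prop) (B : algebra n) : Prop :=
  exists (A : algebra n) (S : subuniverse A),
    K A /\ isomorphic (sub_alg S) B.

Definition class_H n (K : algebra n -> Prop) (B : algebra n) : Prop :=
  exists (A : algebra n) (h : A -> B), [/\ K A, is_hom h & surjective h].

(* The index type may be empty; hence one-element algebras, being subdirect
   products of the empty family, are not subdirectly irreducible. *)
Definition subdirectly_irreducible n (A : algebra n) : Prop :=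
  forall (I : Type) (B : I -> algebra n) (h : A -> prod_alg B),
    is_embedding h -> (forall i, surjective (fun a => h a i)) ->
    exists i, is_iso (fun a => h a i).

Definition injective_in n (K : algebra n -> Prop) (C : algebra n) : Prop :=
  K C /\
  forall (A B : algebra n) (e : A -> B) (g : A -> C),
    K A -> K B -> is_embedding e -> is_hom g ->
    exists h : B -> C, is_hom h /\ forall a, h (e a) = g a.

Definition congruence_extension_property n (K : algebra n -> Prop) : Prop :=
  forall (A : algebra n) (S : subuniverse A) (R : sub_alg S -> sub_alg S -> Prop),
    K A -> is_congruence R ->
    exists2 Q : A -> A -> Prop, is_congruence Q &
      forall x y : sub_alg S, R x y <-> Q (proj1_sig x) (proj1_sig y).

Definition amalgamation_property n (K : algebra n -> Prop) : Prop :=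
  forall (A B C : algebra n) (f : A -> B) (g : A -> C),
    K A -> K B -> K C -> is_embedding f -> is_embedding g ->
    exists (D : algebra n) (f' : B -> D) (g' : C -> D),
      [/\ K D, is_embedding f', is_embedding g' & forall a, f' (f a) = g' (g a)].

Definition has_card (m : nat) (A : Type) : Prop :=
  exists f : A -> 'I_m, bijective f.

(** * The algebras [J_n], [J_{0,n}], [J_{1,n,k}] and the variety [V_n] *)

Definition Jbin n (o : binop) : J n -> J n -> J n :=
  match o with
  | Otimes => @otimes n
  | Oplus => @oplus n
  | Wedge => @wedge n
  | Vee => @vee n
  end.

Definition Jalg n : algebra n := Algebra (@Jbin n) (@Jneg n) id.

(* The algebra in the signature of J_n with the universe and operations of J_m,
   the constants f_i and t_i taking the values f_(r i) and t_(r i). *)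
Definition Jreindex n m (r : 'I_n.+1 -> 'I_m.+1) : algebra n :=
  Algebra (@Jbin m) (@Jneg m)
    (fun c : J n => match c with
     | Jtop => Jtop
     | Jbot => Jbot
     | Jf i => Jf (r i)
     | Jt i => Jt (r i)
     end).

Definition J0alg n : algebra n := @Jreindex n 0 (fun _ => ord0).

(* The elements written 0, f, 1, t in the six-element algebra are [Jf ord0],
   [Jf ord_max], [Jt ord0], [Jt ord_max] here. *)
Definition J1alg n (k : nat) : algebra n :=
  @Jreindex n 1 (fun i => if i < k then ord0 else ord_max).

Definition V n : algebra n -> Prop :=
  class_H (class_S (class_P (fun A => A = Jalg n))).

(* Main.v *)
(* The truth order makes every algebra in V_n a distributive lattice.
   Write an algebra A of V_n as a quotient of a subalgebra of a power of J_n.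
   By a finitary form of Jonsson's lemma, for every prime filter P of A and
   every tuple of elements of A some tuple of constants satisfies, with respect to P,
   the same terms. Hence the quotient of A by the largest congruence
   saturating P is a quotient of J_n, and P is the preimage of a fixed prime
   filter under a homomorphism from A onto J_{0,n} or J_{1,n,k} (after replacing
   P by its De Morgan dual if needed). Prime filters separate points and extend
   along embeddings; the former embeds A into a product of these algebras, which
   gives the classification of the subdirectly irreducible ones, and the latter
   gives their injectivity. Enough injectives, congruence extension and
   amalgamation follow by taking products of all relevant homomorphisms. *)
From HB Require Import structures.
From mathcomp Require Import boolp classical_sets.
Require Import Defs.
From mathcomp Require Import all_boot all_order.

Set Implicit Arguments.
Unset Strict Implicit.
Unset Printing Implicit Defensive.

Import Order.TTheory.

Local Notation "x ⊓ y" := (bin _ Wedge x y) (at level 40, left associativity).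
Local Notation "x ⊔ y" := (bin _ Vee x y) (at level 50, left associativity).
Local Notation "x ⊑ y" := (x ⊓ y = x) (at level 70, no associativity).

(** * Composition and inversion of homomorphisms *)

Lemma comp_hom n (A B C : algebra n) (g : B -> C) (f : A -> B) :
  is_hom f -> is_hom g -> is_hom (g \o f).
Proof.
move=> [fb fn fc] [gb gn gc]; split=> [o x y|x|c] /=.
- by rewrite fb gb.
- by rewrite fn gn.
- by rewrite fc gc.
Qed.

Lemma inverse_hom n (A B : algebra n) (f : A -> B) (g : B -> A) :
  is_hom f -> cancel f g -> cancel g f -> is_hom g.
Proof.
move=> [fb fn fc] fK gK; split=> [o x y|x|c]; apply: (can_inj fK).
- by rewrite fb !gK.
- by rewrite fn !gK.
- by rewrite fc gK.
Qed.

Lemma inj_surj_bij (A B : Type) (f : A -> B) :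
  injective f -> Defs.surjective f -> bijective f.
Proof.
by move=> fI /choice[g gK]; exists g => // a; apply: fI; rewrite gK.
Qed.

(** * Terms and subquotients of powers *)

(** Two variables suffice, since no operation takes more than two arguments. *)
Inductive term n :=
  | TVar of bool | TCst of J n | TBin of binop & term n & term n
  | TNeg of term n.
Arguments TVar {n}.

Fixpoint eval n (A : algebra n) (rho : bool -> A) (t : term n) : A :=
  match t with
  | TVar b => rho b
  | TCst c => cst A c
  | TBin o s t => bin A o (eval rho s) (eval rho t)
  | TNeg t => neg A (eval rho t)
  end.

Fixpoint subst n (s : bool -> term n) (t : term n) : term n :=
  match t with
  | TVar b => s b
  | TCst c => TCst c
  | TBin o t u => TBin o (subst s t) (subst s u)
  | TNeg t => TNeg (subst s t)
  end.

Lemma eval_subst n (A : algebra n) (rho : bool -> A) s t :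
  eval rho (subst s t) = eval (fun b => eval rho (s b)) t.
Proof. by elim: t => //= [o t -> u -> | t ->]. Qed.

Lemma eval_hom n (A B : algebra n) (h : A -> B) rho t :
  is_hom h -> h (eval rho t) = eval (h \o rho) t.
Proof.
move=> [hb hn hc]; elim: t => //= [o t <- u <- | t <-]; first exact: hb.
exact: hn.
Qed.

(** Equivalently, [T] embeds into a power of J_n. *)
Definition separated n (T : algebra n) : Prop := forall x y : T,
  (forall pi : T -> Jalg n, is_hom pi -> pi x = pi y) -> x = y.

(** Working form of membership in HSP(J_n): identities of J_n hold in [T] and descend to [A] along
    [q]. *)
Definition representable n (A : algebra n) : Prop :=
  exists (T : algebra n) (q : T -> A),
    [/\ separated T, is_hom q & Defs.surjective q].

Lemma sval_inj (T : Type) (P : T -> Prop) : injective (@proj1_sig T P).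
Proof. by move=> [x Px] [y Py] /= xy; apply: eq_exist. Qed.

Lemma sub_incl_hom n (A : algebra n) (S : subuniverse A) :
  is_hom (@proj1_sig A S : sub_alg S -> A).
Proof. by []. Qed.

Lemma V_representable n (A : algebra n) : V A -> representable A.
Proof.
move=> [A1 [h [[A2 [S [[I [F [FJ [k [kH [k' kK k'K]]]]]]]]]]]].
move=> [m [mH [m' mK m'K]]] hH hS.
exists (sub_alg S), (h \o m); split; last 1 first.
- by move=> a; have [x <-] := hS a; exists (m' x); rewrite /= m'K.
- move=> x y xy; apply: sval_inj.
  apply: (can_inj k'K); apply: functional_extensionality_dep => i.
  have [f [fH fI]] : exists f : F i -> Jalg n, is_hom f /\ injective f.
    by rewrite FJ; exists id; split; first split.
  apply: fI; apply: (xy (fun x => f (k' (sval x) i))).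
  have [k'b k'n k'c] := inverse_hom kH kK k'K.
  have [fb fn fc] := fH.
  split=> [o u v|u|c] /=; first by rewrite k'b; exact: fb.
    by rewrite k'n; exact: fn.
  by rewrite k'c; exact: fc.
- exact: comp_hom.
Qed.

Lemma representable_surj n (A B : algebra n) (h : A -> B) :
  is_hom h -> Defs.surjective h -> representable A -> representable B.
Proof.
move=> hH hS [T [q [Ts qH qS]]]; exists T, (h \o q); split=> //.
  exact: comp_hom.
by move=> b; have [a <-] := hS b; have [t <-] := qS a; exists t.
Qed.

(** The preimage of [S] under [q] is a subuniverse of [T] that maps onto [S]. *)
Lemma representable_sub n (A : algebra n) (S : subuniverse A) :
  representable A -> representable (sub_alg S).
Proof.
move=> [T [q [Ts [qb qn qc] qS]]].
have Sb o x y : S (q x) -> S (q y) -> S (q (bin T o x y)).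
  by rewrite qb; apply: sub_bin.
have Sn x : S (q x) -> S (q (neg T x)) by rewrite qn; apply: sub_neg.
have Sc c : S (q (cst T c)) by rewrite qc; apply: sub_cst.
pose U := Subuniverse Sb Sn Sc.
exists (sub_alg U).
pose qU (u : sub_alg U) : sub_alg S := exist S (q (sval u)) (proj2_sig u).
exists qU; split.
- move=> x y xy; apply: sval_inj.
  apply: Ts => pi [pb pn pc]; apply: (xy (fun u => pi (sval u))).
  by split=> [o u v|u|c] /=.
- by split=> [o x y|x|c]; apply: sval_inj => /=.
- move=> [a Sa]; have [x qx] := qS a.
  have Sx : U x by rewrite /= qx.
  by exists (exist _ x Sx); apply: sval_inj.
Qed.

(** Every element of J_n is named by a constant, so its operation tables are identities between
    closed terms, and these hold in [A]. *)
Lemma cst_hom n (A : algebra n) : representable A ->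
  is_hom (cst A : Jalg n -> A).
Proof.
move=> [T [q [Ts [qb qn qc] qS]]]; split=> [o x y|x|c] //=.
- rewrite -!qc -qb; congr q; apply: Ts => pi [pb pn pc].
  by rewrite pb !pc.
- by rewrite -!qc -qn; congr q; apply: Ts => pi [pb pn pc]; rewrite pn !pc.
Qed.

(** * The truth lattice *)

Lemma ord_max_maxl n (i : 'I_n.+1) : Order.max ord_max i = ord_max.
Proof. by apply: max_idPl; apply: leq_ord. Qed.

Lemma ord_max_minl n (i : 'I_n.+1) : Order.min ord_max i = i.
Proof. by apply: min_idPr; apply: leq_ord. Qed.
Definition ordE n := (@ord_max_maxl n, @ord_max_minl n,
  fun i => etrans (maxC i ord_max) (@ord_max_maxl n i),
  fun i => etrans (minC i ord_max) (@ord_max_minl n i)).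

Lemma wedgeC n : commutative (@wedge n).
Proof. by case=> [||i|i] [||j|j] //=; rewrite ?(minC i) ?(maxC i). Qed.

Lemma veeC n : commutative (@vee n).
Proof. by case=> [||i|i] [||j|j] //=; rewrite ?(minC i) ?(maxC i). Qed.

Lemma wedgeA n : associative (@wedge n).
Proof. by case=> [||i|i] [||j|j] [||k|k] //=; rewrite ?ordE ?minA ?maxA. Qed.

Lemma wedgexx n : idempotent_op (@wedge n).
Proof. by case=> [||i|i] //=; rewrite ?minxx ?maxxx. Qed.

Lemma wedge_veeK n (x y : J n) : wedge x (vee x y) = x.
Proof.
case: x y => [||i|i] [||j|j] //=; by rewrite ?ordE ?maxKx ?minKx ?minxx ?maxxx.
Qed.

Lemma wedge_veer n : right_distributive (@wedge n) (@vee n).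
Proof.
case=> [||i|i] [||j|j] [||k|k] //=.
all: rewrite ?ordE ?minxx ?maxxx ?(maxC _ i) ?maxKx ?minKx //.
all: congr (_ _); rewrite -?(maxC i).
- exact: min_maxr.
- exact: max_minr.
Qed.

Lemma Jneg_wedge n : {morph @Jneg n : x y / wedge x y >-> vee x y}.
Proof. by case=> [||i|i] [||j|j]. Qed.

Lemma Jneg_vee n : {morph @Jneg n : x y / vee x y >-> wedge x y}.
Proof. by case=> [||i|i] [||j|j]. Qed.

Lemma JnegK n : involutive (@Jneg n).
Proof. by case. Qed.

Section TruthLattice.

Variables (n : nat) (A : algebra n).
Hypothesis Arep : representable A.
Implicit Types x y z : A.

(** Like the laws up to [negK], this is an identity of J_n: the arguments are lifted along [q] and
    compared under every homomorphism into J_n. *)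
Lemma meetC x y : x ⊓ y = y ⊓ x.
Proof.
have [T [q [Ts [qb _ _] qS]]] := Arep.
have [[x' <-] [y' <-]] := (qS x, qS y).
rewrite -!qb; congr q; apply: Ts => pi [pb _ _]; rewrite !pb; exact: wedgeC.
Qed.

Lemma joinC x y : x ⊔ y = y ⊔ x.
Proof.
have [T [q [Ts [qb _ _] qS]]] := Arep.
have [[x' <-] [y' <-]] := (qS x, qS y).
rewrite -!qb; congr q; apply: Ts => pi [pb _ _]; rewrite !pb; exact: veeC.
Qed.

Lemma meetA x y z : x ⊓ (y ⊓ z) = x ⊓ y ⊓ z.
Proof.
have [T [q [Ts [qb _ _] qS]]] := Arep.
have [[[x' <-] [y' <-]] [z' <-]] := (qS x, qS y, qS z).
rewrite -!qb; congr q; apply: Ts => pi [pb _ _]; rewrite !pb; exact: wedgeA.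
Qed.

Lemma meetxx x : x ⊓ x = x.
Proof.
have [T [q [Ts [qb _ _] qS]]] := Arep; have [x' <-] := qS x.
rewrite -!qb; congr q; apply: Ts => pi [pb _ _]; rewrite !pb; exact: wedgexx.
Qed.

Lemma meet_joinK x y : x ⊓ (x ⊔ y) = x.
Proof.
have [T [q [Ts [qb _ _] qS]]] := Arep.
have [[x' <-] [y' <-]] := (qS x, qS y).
rewrite -!qb; congr q; apply: Ts => pi [pb _ _]; rewrite !pb.
exact: wedge_veeK.
Qed.

Lemma meet_joinr x y z : x ⊓ (y ⊔ z) = (x ⊓ y) ⊔ (x ⊓ z).
Proof.
have [T [q [Ts [qb _ _] qS]]] := Arep.
have [[[x' <-] [y' <-]] [z' <-]] := (qS x, qS y, qS z).
rewrite -!qb; congr q; apply: Ts => pi [pb _ _]; rewrite !pb.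
exact: wedge_veer.
Qed.

Lemma neg_meet x y : neg A (x ⊓ y) = neg A x ⊔ neg A y.
Proof.
have [T [q [Ts [qb qn _] qS]]] := Arep.
have [[x' <-] [y' <-]] := (qS x, qS y).
rewrite -!(qb, qn); congr q; apply: Ts => pi [pb pn _]; rewrite !(pb, pn).
exact: Jneg_wedge.
Qed.

Lemma neg_join x y : neg A (x ⊔ y) = neg A x ⊓ neg A y.
Proof.
have [T [q [Ts [qb qn _] qS]]] := Arep.
have [[x' <-] [y' <-]] := (qS x, qS y).
rewrite -!(qb, qn); congr q; apply: Ts => pi [pb pn _]; rewrite !(pb, pn).
exact: Jneg_vee.
Qed.

Lemma negK x : neg A (neg A x) = x.
Proof.
have [T [q [Ts [_ qn _] qS]]] := Arep; have [x' <-] := qS x.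
rewrite -!qn; congr q; apply: Ts => pi [_ pn _]; rewrite !pn; exact: JnegK.
Qed.

Lemma le_trans y x z : x ⊑ y -> y ⊑ z -> x ⊑ z.
Proof. by move=> <- yz; rewrite -meetA yz. Qed.

Lemma le_meetl x y : x ⊓ y ⊑ x.
Proof. by rewrite meetC meetA meetxx. Qed.

Lemma le_meetr x y : x ⊓ y ⊑ y.
Proof. by rewrite -meetA meetxx. Qed.

Lemma le_meet x y z : x ⊑ y -> x ⊑ z -> x ⊑ y ⊓ z.
Proof. by move=> xy xz; rewrite meetA xy. Qed.

Lemma le_joinr x y : y ⊑ x ⊔ y.
Proof. by rewrite joinC meet_joinK. Qed.

Lemma join_le x y z : x ⊑ z -> y ⊑ z -> x ⊔ y ⊑ z.
Proof. by move=> xz yz; rewrite meetC meet_joinr !(meetC z) xz yz. Qed.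

(** The empty set and the whole algebra count as prime filters here. *)
Definition prime_filter (P : A -> Prop) : Prop :=
  (forall x y, P (x ⊓ y) <-> P x /\ P y) /\
  (forall x y, P (x ⊔ y) <-> P x \/ P y).

Lemma prime_filter_le (P : A -> Prop) x y :
  prime_filter P -> x ⊑ y -> P x -> P y.
Proof. by move=> [Pm _] <- /Pm[]. Qed.

Lemma prime_filter_dual (P : A -> Prop) :
  prime_filter P -> prime_filter (fun x => ~ P (neg A x)).
Proof.
move=> [Pm Pj]; split=> x y.
  by rewrite neg_meet Pj not_orP.
by rewrite neg_join Pm not_andP.
Qed.

(** * The prime filter theorem for distributive lattices *)

Section Separation.

Variables F G : A -> Prop.
Hypothesis FI : forall x y, F x -> F y -> F (x ⊓ y).
Hypothesis GU : forall x y, G x -> G y -> G (x ⊔ y).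
Hypothesis FG : forall x y, F x -> G y -> ~ x ⊑ y.

(** The last clause makes [X] contain [F] only once [X] is nonempty, so that the union of the empty
    chain is good as well. *)
Let good (X : set A) : Prop :=
  [/\ forall x y, X x -> x ⊑ y -> X y, forall x y, X x -> X y -> X (x ⊓ y),
      forall x, X x -> ~ G x & forall x f, X x -> F f -> X f].

(** Zorn's lemma yields a maximal good set [M]; distributivity makes it prime. *)
Lemma prime_filter_separation : exists P, [/\ prime_filter P,
  forall x, F x -> P x & forall x, G x -> ~ P x].
Proof.
have [C CP Ctot|M [[Mup MI MG MF] Mmax]] := @Zorn_bigcup A good.
  split.
  - by move=> x y [X CX Xx] xy; exists X => //; have [up _ _ _] := CP _ CX;
      apply: up xy.
  - move=> x y [X CX Xx] [Y CY Yy].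
    have [XY|YX] := Ctot _ _ CX CY.
      by exists Y => //; have [_ I _ _] := CP _ CY; apply: I => //; apply: XY.
    by exists X => //; have [_ I _ _] := CP _ CX; apply: I => //; apply: YX.
  - by move=> x [X CX Xx]; have [_ _ + _] := CP _ CX; apply.
  - by move=> x f [X CX Xx] Ff; exists X => //; have [_ _ _ XF] := CP _ CX;
      apply: XF Xx Ff.
have {}Mmax X : good X -> (forall x, M x -> X x) -> forall x, X x -> M x.
  move=> Xg MX x Xx; apply: contrapT => Mx; apply: (Mmax X) => //.
  by split=> // /(_ _ Xx).
have FM f : F f -> M f.
  move=> Ff; have [[x Mx]|M0] := EM (exists x, M x); first exact: MF Mx Ff.
  (* If [M] is empty, the up-closure of [F] is a good set containing it, so maximality applies. *)
  apply: (Mmax (fun x => exists2 g, F g & g ⊑ x)) => [|x Mx|].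
  - split.
    + by move=> x y [g Fg gx] xy; exists g => //; apply: le_trans xy.
    + move=> x y [g Fg gx] [k Fk ky]; exists (g ⊓ k); first exact: FI.
      by apply: le_meet; [apply: le_trans gx | apply: le_trans ky];
        [apply: le_meetl | apply: le_meetr].
    + by move=> x [g Fg gx] Gx; apply: FG gx.
    + by move=> x g _ Fg; exists g => //; apply: meetxx.
  - by case: M0; exists x.
  - by exists f => //; apply: meetxx.
(* The filter generated by [M] and [x] must meet [G]; otherwise it would be good and, by maximality,
   [x] would lie in [M]. *)
have step z x : M z -> ~ M x ->
    exists m i, [/\ M m, G i & m ⊓ x ⊑ i].
  move=> Mz Mx; apply: contrapT => no; apply: Mx.
  apply: (Mmax (fun y => exists2 m, M m & m ⊓ x ⊑ y)) => [|y My|].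
  - split.
    + by move=> y w [m Mm my] yw; exists m => //; apply: le_trans yw.
    + move=> y w [m Mm my] [k Mk kw]; exists (m ⊓ k); first exact: MI.
      apply: le_meet; [apply: le_trans my | apply: le_trans kw];
        (apply: le_meet; last exact: le_meetr);
        apply: (le_trans (le_meetl _ _));
        [apply: le_meetl | apply: le_meetr].
    + by move=> y [m Mm my] Gy; apply: no; exists m, y.
    + by move=> y f _ /FM Mf; exists f => //; apply: le_meetl.
  - by exists y => //; apply: le_meetl.
  - by exists z => //; apply: le_meetr.
exists M; split=> //; last by move=> x Gx /MG.
split=> x y; split.
- by move=> Mxy; split; apply: Mup Mxy _; [apply: le_meetl | apply: le_meetr].
- by move=> [Mx My]; apply: MI.
- move=> Mxy; apply: contrapT => /not_orP[Mx My].
  have [m [i [Mm Gi mi]]] := step _ _ Mxy Mx.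
  have [k [j [Mk Gj kj]]] := step _ _ Mxy My.
  (* By distributivity, the meet of [m], [k] and [x ⊔ y] lies below [i ⊔ j]. *)
  apply: (MG (i ⊔ j)); last exact: GU.
  apply: Mup (MI _ _ (MI _ _ Mm Mk) Mxy) _.
  rewrite (meet_joinr _ x y); apply: join_le.
    apply: le_trans (meet_joinK i j); apply: le_trans mi.
    apply: le_meet; last exact: le_meetr.
    by apply: (le_trans (le_meetl _ _)); apply: le_meetl.
  apply: le_trans (le_joinr i j); apply: le_trans kj.
  apply: le_meet; last exact: le_meetr.
  by apply: (le_trans (le_meetl _ _)); apply: le_meetr.
- move=> [Mx|My]; first by apply: Mup Mx _; apply: meet_joinK.
  by apply: Mup My _; apply: le_joinr.
Qed.

End Separation.

End TruthLattice.

(** * Prime filters and homomorphisms *)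

Definition same_type n (A B : algebra n) (P : A -> Prop) (Q : B -> Prop)
    (rho : bool -> A) (sigma : bool -> B) : Prop :=
  forall t, P (eval rho t) <-> Q (eval sigma t).

Lemma separated_representable n (T : algebra n) :
  separated T -> representable T.
Proof. by move=> Ts; exists T, id; split=> // b; exists b. Qed.

Lemma Jalg_separated n : separated (Jalg n).
Proof. by move=> x y; apply. Qed.

(** * Finiteness of J_n, and types of tuples with respect to a prime filter *)

Definition Jencode n (x : J n) : option (option ('I_n.+1 + 'I_n.+1)) :=
  match x with
  | Jtop => None
  | Jbot => Some None
  | Jf i => Some (Some (inl i))
  | Jt i => Some (Some (inr i))
  end.

Definition Jdecode n (x : option (option ('I_n.+1 + 'I_n.+1))) : J n :=
  match x with
  | None => Jtop
  | Some None => Jbot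
  | Some (Some (inl i)) => Jf i
  | Some (Some (inr i)) => Jt i
  end.

Lemma JencodeK n : cancel (@Jencode n) (@Jdecode n).
Proof. by case. Qed.

Lemma JdecodeK n : cancel (@Jdecode n) (@Jencode n).
Proof. by do 3?case. Qed.

HB.instance Definition _ n := Finite.copy (J n) (can_type (@JencodeK n)).

Lemma card_J n : #|{: J n}| = n.*2 + 4.
Proof.
rewrite (bij_eq_card (Bijective (@JencodeK n) (@JdecodeK n))).
by rewrite !card_option card_sum card_ord addnn doubleS !addnS addn0.
Qed.

(* Were the claim false, every pair of constants would provide u in P and v
   outside P agreeing on those coordinates where rho takes these values. Such
   pairs can be merged so as to agree on a union of two sets of coordinates, and
   finitely many of these sets exhaust all coordinates. *)
Lemma separated_type n (T : algebra n) (P : T -> Prop) rho :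
  separated T -> prime_filter P ->
  exists sigma : bool -> J n, same_type P P rho (cst T \o sigma).
Proof.
move=> Ts [Pm Pj]; have Trep := separated_representable Ts.
have Jrep := separated_representable (@Jalg_separated n).
apply: contrapT => no.
have one c d : exists u v, [/\ P u, ~ P v & forall pi : T -> Jalg n,
    is_hom pi -> pi (rho true) = c -> pi (rho false) = d -> pi u = pi v].
  have [t Pt] : exists t, ~ (P (eval rho t) <->
      P (eval (cst T \o (fun b : bool => if b then c else d)) t)).
    apply/existsNP => H; apply: no.
    by exists (fun b : bool => if b then c else d).
  set s := (X in ~ (_ <-> P (eval X _))) in Pt.
  have eq pi : is_hom pi -> pi (rho true) = c -> pi (rho false) = d ->
      pi (eval rho t) = pi (eval s t).
    move=> piH pic pid; rewrite !eval_hom //; congr eval; apply: funext.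
    by have [_ _ pc] := piH; case=> /=; rewrite pc ?pic ?pid.
  have [Pr|Pr] := EM (P (eval rho t)).
    by exists (eval rho t), (eval s t); split=> // /(conj Pr)[? ?]; apply: Pt.
  have Psg : P (eval s t) by apply: contrapT => Ps; apply: Pt.
  exists (eval s t), (eval rho t); split=> // pi piH pic pid.
  exact/esym/eq.
have many (s : seq (J n * J n)) : exists u v, [/\ P u, ~ P v &
    forall pi : T -> Jalg n, is_hom pi ->
      (pi (rho true), pi (rho false)) \in s -> pi u = pi v].
  elim: s => [|[c d] s [u [v [Pu Pv uv]]]].
    by have [u [v [Pu Pv _]]] := one Jtop Jtop; exists u, v.
  have [u' [v' [Pu' Pv' uv']]] := one c d.
  (* Where [u = v] or [u' = v'], the meet [u ⊓ u'] lies below [v ⊔ v'], so the new pair agrees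
     there; primeness keeps [v ⊔ v'] outside [P]. *)
  exists (u ⊓ u'), (u ⊓ u' ⊓ (v ⊔ v')); split.
  - by apply/Pm.
  - by move=> /Pm[_] /Pj[].
  - move=> pi piH; have [pb _ _] := piH.
    rewrite inE xpair_eqE => /orP[/andP[/eqP pic /eqP pid]|/uv]; rewrite !pb.
      rewrite -uv' //; apply/esym.
      exact: le_trans (le_meetr Jrep _ _) (le_joinr Jrep _ _).
    move=> <- //; apply/esym.
    exact: le_trans (le_meetl Jrep _ _) (meet_joinK Jrep _ _).
have [u [v [Pu Pv uv]]] := many (enum {: J n * J n}).
by apply: Pv; rewrite -(Ts u v) // => pi piH; apply: uv => //; rewrite mem_enum.
Qed.

Lemma prime_filter_preim n (A B : algebra n) (h : A -> B) (P : B -> Prop) :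
  is_hom h -> prime_filter P -> prime_filter (P \o h).
Proof. by move=> [hb _ _] [Pm Pj]; split=> x y; rewrite /= hb. Qed.

Lemma representable_type n (A : algebra n) (P : A -> Prop) rho :
  representable A -> prime_filter P ->
  exists sigma : bool -> J n, same_type P P rho (cst A \o sigma).
Proof.
move=> [T [q [Ts qH qS]]] PP; have [r rE] := choice (fun b => qS (rho b)).
have [s sP] := separated_type r Ts (prime_filter_preim qH PP).
exists s => t; have := sP t; rewrite /= !eval_hom //.
have -> : q \o r = rho by apply: funext => b; apply: rE.
suff -> : q \o (cst T \o s) = cst A \o s by [].
by apply: funext => b /=; case: qH.
Qed.

(* The largest congruence saturating Q is trivial; because the constants of J_n
   name every element of the algebras of interest, terms with constants suffice
   in place of polynomials. *)
Definition reduced n (C : algebra n) (Q : C -> Prop) : Prop :=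
  forall v w, same_type Q Q (fun=> v) (fun=> w) -> v = w.

(** The image of [x] is the element of [C] having the type of [x]: it exists because [x] has the
    type of a constant, and is unique because [Q] is reduced. Types of pairs show that this map
    preserves the binary operations. *)
Lemma prime_filter_hom n (A C : algebra n) (P : A -> Prop) (Q : C -> Prop) :
  representable A -> representable C -> reduced Q -> prime_filter P ->
  (forall c, P (cst A c) <-> Q (cst C c)) ->
  exists h : A -> C, is_hom h /\ forall x, P x <-> Q (h x).
Proof.
move=> Arep Crep Qred PP PQ.
have types rho : exists sigma : bool -> C, same_type P Q rho sigma.
  have [s sP] := representable_type rho Arep PP.
  exists (cst C \o s) => t; rewrite sP.
  (* A closed term has the value in J_n of some constant, so agreement of [P] and [Q] on constants
     gives agreement on all closed terms. *)
  have := PQ (eval (A := Jalg n) s t).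
  by rewrite !eval_hom //; apply: cst_hom.
(* By substitution, the type of a pair determines the type of every term evaluated at that pair. *)
have type1 rho sigma s : same_type P Q rho sigma ->
    same_type P Q (fun=> eval rho s) (fun=> eval sigma s).
  by move=> H t; have := H (subst (fun=> s) t); rewrite !eval_subst.
have [|h hP] := choice (P := fun x v => same_type P Q (fun=> x) (fun=> v)).
  move=> x; have [s sP] := types (fun=> x); exists (s true).
  exact: (type1 _ _ (TVar true)) sP.
have hE x v : same_type P Q (fun=> x) (fun=> v) -> h x = v.
  by move=> H; apply: Qred => t; rewrite -hP -H.
exists h; split; last by move=> x; apply: (hP x (TVar true)).
split=> [o x y|x|c].
- have [s sP] := types (fun b : bool => if b then x else y).
  rewrite (hE _ _ (type1 _ _ (TVar true) sP)).
  rewrite (hE _ _ (type1 _ _ (TVar false) sP)).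
  exact: hE (type1 _ _ (TBin o (TVar true) (TVar false)) sP).
- exact: hE (type1 _ _ (TNeg (TVar true)) (hP x)).
- exact: hE (type1 _ _ (TCst c) (hP (cst A c))).
Qed.

Lemma reduced_hom_eq n (A C : algebra n) (Q : C -> Prop) (g h : A -> C) :
  reduced Q -> is_hom g -> is_hom h -> (forall x, Q (g x) <-> Q (h x)) ->
  forall x, g x = h x.
Proof.
move=> Qred gH hH gh x; apply: Qred => t.
by have := gh (eval (fun=> x) t); rewrite !eval_hom.
Qed.

(** Separating the images under [e] of [Q \o g] and of its complement gives a prime filter of [B]
    whose preimage under [e] is [Q \o g]. The homomorphism it induces agrees with [g] on [A] because
    [Q] is reduced. *)
Lemma reduced_extension n (A B C : algebra n) (Q : C -> Prop) (e : A -> B)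
    (g : A -> C) :
  representable A -> representable B -> representable C ->
  prime_filter Q -> reduced Q -> is_embedding e -> is_hom g ->
  exists h : B -> C, is_hom h /\ forall a, h (e a) = g a.
Proof.
move=> Arep Brep Crep QP Qred [eH eI] gH.
have [eb en ec] := eH; have [gb gn gc] := gH; have [Qm Qj] := QP.
have [| | |P [PP FP GP]] := @prime_filter_separation _ B Brep
  (fun b => exists2 a, Q (g a) & e a = b)
  (fun b => exists2 a, ~ Q (g a) & e a = b).
- move=> _ _ [a Qa <-] [b Qb <-]; exists (a ⊓ b); last exact: eb.
  by rewrite gb; apply/Qm.
- move=> _ _ [a Qa <-] [b Qb <-]; exists (a ⊔ b); last exact: eb.
  by rewrite gb; apply/Qj => -[].
- move=> _ _ [a Qa <-] [b Qb <-]; rewrite -eb => /eI ab; apply: Qb.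
  apply: prime_filter_le QP _ Qa.
  by rewrite -gb ab.
have Pe a : P (e a) <-> Q (g a).
  split=> Pa; last by apply: FP; exists a.
  by apply: contrapT => Qa; apply: GP Pa; exists a.
have [|h [hH hP]] := prime_filter_hom Brep Crep Qred PP.
  by move=> c; rewrite -ec Pe gc.
exists h; split=> //; apply: reduced_hom_eq Qred (comp_hom eH hH) gH _ => x /=.
by rewrite -hP Pe.
Qed.

(** * The algebras [J_{0,n}] and [J_{1,n,k}] *)

Definition Jmap n m (r : 'I_n.+1 -> 'I_m.+1) (c : J n) : J m :=
  match c with
  | Jtop => Jtop
  | Jbot => Jbot
  | Jf i => Jf (r i)
  | Jt i => Jt (r i)
  end.

(** A monotone [r] commutes with minima and maxima. Fixing the last index is needed because the
    truth meet and join of top and bot are f_n and t_n. *)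
Lemma Jmap_hom n m (r : 'I_n.+1 -> 'I_m.+1) :
  {homo r : i j / i <= j} -> r ord_max = ord_max ->
  is_hom (Jmap r : Jalg n -> Jreindex r).
Proof.
move=> rmono rmax.
have rmin i j : r (Order.min i j) = Order.min (r i) (r j).
  have [ij|/ltnW ij] := leqP i j.
    by rewrite !min_l //; apply: rmono.
  by rewrite !min_r //; apply: rmono.
have rmaxE i j : r (Order.max i j) = Order.max (r i) (r j).
  have [ij|/ltnW ij] := leqP i j.
    by rewrite !max_r //; apply: rmono.
  by rewrite !max_l //; apply: rmono.
split=> // [|x]; last by case: x.
by case=> [] [||i|i] [||j|j] //=; rewrite ?rmax ?rmin ?rmaxE.
Qed.

(** One family for all n+1 algebras, with J_{0,n} at index 0. *)
Definition gen n (k : nat) : algebra n := if k is 0 then J0alg n else J1alg n k.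

(** The truth filter generated by top in J_{0,n}, and by f in J_{1,n,k}. *)
Definition gen_filter n (k : nat) : gen n k -> Prop :=
  match k with
  | 0 => fun x : J 0 => if x is (Jtop | Jt _) then true else false
  | k'.+1 => fun x : J 1 => if x is Jf i then i != ord0 else true
  end.
Arguments gen_filter {n}.

Lemma ord2P (i : 'I_2) : i = ord0 \/ i = ord_max.
Proof. by case: i => [[|[|m]] Hm] //; [left|right]; apply: val_inj. Qed.

Lemma cst_gen_hom n k : k <= n -> is_hom (cst (gen n k) : Jalg n -> gen n k).
Proof.
case: k => [|k] kn; first by apply: Jmap_hom => //; apply: val_inj.
apply: Jmap_hom; last by rewrite /= ltnNge kn.
move=> i j ij /=; case: (ltnP j k.+1) => [jk|_]; last exact: leq_ord.
by rewrite (leq_ltn_trans ij jk).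
Qed.

Lemma cst_gen_surj n k : k <= n -> Defs.surjective (cst (gen n k)).
Proof.
case: k => [|k] kn; case=> [||i|i].
- by exists Jtop.
- by exists Jbot.
- by exists (Jf ord0); rewrite /= (ord1 i).
- by exists (Jt ord0); rewrite /= (ord1 i).
- by exists Jtop.
- by exists Jbot.
- have [->|->] := ord2P i; first by exists (Jf ord0).
  by exists (Jf ord_max); rewrite /= ltnNge kn.
- have [->|->] := ord2P i; first by exists (Jt ord0).
  by exists (Jt ord_max); rewrite /= ltnNge kn.
Qed.

Lemma hom_gen_surj n k (A : algebra n) (h : A -> gen n k) :
  k <= n -> is_hom h -> Defs.surjective h.
Proof.
by move=> kn [_ _ hc] x; have [c <-] := cst_gen_surj kn x; exists (cst A c).
Qed.

Lemma gen_representable n k : k <= n -> representable (gen n k).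
Proof.
move=> kn; apply: representable_surj (cst_gen_hom kn) (cst_gen_surj kn) _.
exact/separated_representable/Jalg_separated.
Qed.

Lemma gen_filter_prime n k : prime_filter (@gen_filter n k).
Proof.
case: k => [|k]; split.
- by case=> [||i|i] [||j|j] //=; split=> // -[].
- by case=> [||i|i] [||j|j] //=; split=> //; try case; auto.
- case=> [||i|i] [||j|j] //=; try by split=> // -[].
  by have [->|->] := ord2P i; have [->|->] := ord2P j; split=> // -[].
- case=> [||i|i] [||j|j] //=; try by split=> //; try case; auto.
  have [->|->] := ord2P i; have [->|->] := ord2P j.
  all: by split=> //; try case; auto.
Qed.

Lemma iff_eq_bool (a b : bool) : (a <-> b) -> a = b.
Proof. by move=> ab; apply/idP/idP => /ab. Qed.

(** In J_{0,n} the terms x and ¬x distinguish all elements. In J_{1,n,k} they single out 0 and 1;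
    among the rest, x ⊗ 0 singles out top, x ⊕ 0 splits t from bot and f, and ¬(x ⊕ 1) splits bot
    from f. *)
Lemma gen_filter_reduced n k : reduced (@gen_filter n k).
Proof.
case: k => [|k] v w H; move: v w H; first last.
  move=> v w H; have H0 := H (TVar true); have H1 := H (TNeg (TVar true)).
  have H2 := H (TBin Otimes (TVar true) (TCst (Jf ord0))).
  have H3 := H (TBin Oplus (TVar true) (TCst (Jf ord0))).
  have H4 := H (TNeg (TBin Oplus (TVar true) (TCst (Jt ord0)))).
  move: v w H0 H1 H2 H3 H4 {H} => [||i|i] [||j|j] //=.
  all: try (have [->|->] := ord2P i); try (have [->|->] := ord2P j).
  all: do 5?[move=> /iff_eq_bool; try by []; move=> _].
move=> v w H; have H0 := H (TVar true); have H1 := H (TNeg (TVar true)).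
move: v w H0 H1 {H} => [||i|i] [||j|j] //=; rewrite ?(ord1 i) ?(ord1 j) //.
all: do 2?[move=> /iff_eq_bool; try by []; move=> _].
Qed.

(** * Separation by homomorphisms onto [J_{0,n}] and [J_{1,n,k}] *)

Section Trace.

Variables (n : nat) (p : Jalg n -> Prop).
Hypothesis pP : prime_filter p.

Lemma inord_max : inord n = ord_max :> 'I_n.+1.
Proof. by apply: val_inj; rewrite /= inordK. Qed.

(** The index [k] is the least one with f_k in [p]. It is positive, since f_0 in [p] would put every
    element in [p]. *)
Lemma trace_f : p (Jf ord_max) -> (exists c, ~ p c) ->
  exists2 k, k <= n & forall c, p c <-> gen_filter k (cst (gen n k) c).
Proof.
move=> pn [c0 pc0]; have [pm pj] := pP.
have le x y : wedge x y = x -> p x -> p y.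
  by move=> xy; apply: (prime_filter_le (A := Jalg n) pP xy).
have pF (i j : 'I_n.+1) : i <= j -> p (Jf i) -> p (Jf j).
  by move=> ij; apply: le; rewrite /= min_l.
have p0 : ~ p (Jf ord0).
  move=> p0; apply: pc0; apply: le p0; case: c0 => //= i.
  by rewrite min_l.
have ex : exists k, `[< p (Jf (inord k)) >].
  by exists n; apply/asboolP; rewrite inord_max.
case: (ex_minnP ex) => k /asboolP pk kmin.
have kn : k <= n.
  by apply: kmin; apply/asboolP; rewrite inord_max.
case: k kn pk kmin => [|k] kn pk kmin.
  by case: p0; rewrite (_ : ord0 = inord 0) //; apply: val_inj;
    rewrite /= inordK.
exists k.+1 => // -[||i|i] /=.
- by split=> // _; apply: le pn.
- by split=> // _; apply: le pn.
- split=> [pi|]; last first.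
    by case: ltnP => // ik _; apply: pF pk; rewrite inordK.
  case: ltnP => // ik.
    rewrite -(inord_val i) in pi; have := kmin _ (asboolT pi).
    by rewrite leqNgt ik.
- by split=> // _; apply: le pn.
Qed.

End Trace.

(* The nontrivial prime filters of J_n are generated by f_i with 0 < i, by top,
   and by their De Morgan duals: by t_i with i < n and by bot. *)
Lemma trace_gen n (p : Jalg n -> Prop) :
  prime_filter p -> (exists c, p c) -> (exists c, ~ p c) ->
  exists2 k, k <= n &
    (forall c, p c <-> gen_filter k (cst (gen n k) c)) \/
    (forall c, ~ p (Jneg c) <-> gen_filter k (cst (gen n k) c)).
Proof.
move=> pP [c1 p1] [c0 p0]; have [pm pj] := pP.
have Jrep := separated_representable (@Jalg_separated n).
have [pf|pf] := EM (p (Jf ord_max)).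
  by have [|k kn pk] := trace_f pP pf; [exists c0 | exists k => //; left].
(* If t_n is outside [p], the De Morgan dual contains f_n and the previous case applies to it. *)
have [pt|pt] := EM (p (Jt ord_max)); last first.
  have [|k kn pk] := trace_f (prime_filter_dual Jrep pP) pt.
    by exists (Jneg c1); rewrite /= JnegK => /(_ p1).
  by exists k => //; right.
have le x y : wedge x y = x -> p x -> p y.
  by move=> xy; apply: (prime_filter_le (A := Jalg n) pP xy).
have pfi i : ~ p (Jf i).
  by move=> pi; apply: pf; apply: le pi; rewrite /= min_l //; apply: leq_ord.
have pti i : p (Jt i) by apply: le pt; rewrite /= max_l //; apply: leq_ord.
(* Since top ∧ bot = f_n is outside [p] and top ∨ bot = t_n is inside, exactly one of top and bot
   lies in [p]. *)
have := pm Jtop Jbot; have := pj Jtop Jbot; rewrite /=.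
move=> -[/(_ pt)+ _] [_ nboth].
have {}nboth : ~ (p Jtop /\ p Jbot) by move=> /nboth.
move=> some; exists 0 => //.
have [ptop|ntop] := EM (p Jtop); [left|right]; case=> [||i|i]; split=> //=.
- by move=> pb; case: nboth.
- by move=> /pfi.
- by case: some.
Qed.

(** A prime filter containing just one of the two elements, or its De Morgan dual, has on the
    constants the trace of some [gen_filter], hence is the preimage of it under a homomorphism. *)
Lemma gen_separation n (A : algebra n) (x y : A) : representable A -> x <> y ->
  exists k : 'I_n.+1, exists h : A -> gen n k, is_hom h /\ h x <> h y.
Proof.
move=> Arep xy.
wlog nle : x y xy / ~ x ⊑ y.
  move=> H; have [le|] := EM (x ⊑ y); last exact: H.
  have [||k [h [hH hxy]]] := H y x; first by move=> yx; apply: xy.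
    by move=> le'; apply: xy; rewrite -le meetC.
  by exists k, h; split=> // E; apply: hxy.
have [| | |P [PP FP GP]] := @prime_filter_separation _ A Arep
  (fun z => x ⊑ z) (fun z => z ⊑ y).
- by move=> *; apply: le_meet.
- by move=> *; apply: join_le.
- move=> u v xu vy uv; apply: nle.
  by apply: le_trans vy => //; apply: le_trans uv.
have Px : P x by apply: FP; apply: meetxx.
have Py : ~ P y by apply: GP; apply: meetxx.
(* Transfers membership of [x] and non-membership of [y] to constants, so that the trace of [P] on
   J_n is nontrivial. *)
have named z : exists c, P z <-> P (cst A c).
  have [s sP] := representable_type (fun=> z) Arep PP.
  by exists (s true); apply: (sP (TVar true)).
have cH := cst_hom Arep.
have [| |k kn tr] := trace_gen (prime_filter_preim cH PP).
- by have [c Pc] := named x; exists c; apply/Pc.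
- by have [c Pc] := named y; exists c => /Pc.
have kn' : k < n.+1 by [].
exists (Ordinal kn') => /=; have Grep := gen_representable kn.
have Qred := @gen_filter_reduced n k.
case: tr => tr.
  have [h [hH hP]] := prime_filter_hom Arep Grep Qred PP tr.
  by exists h; split=> // E; apply: Py; apply/hP; rewrite -E; apply/hP.
have PP' := prime_filter_dual Arep PP.
have [|h [hH hP]] := prime_filter_hom Arep Grep Qred PP'.
  by move=> c; rewrite -tr /=; have [_ cn _] := cH; rewrite -cn.
exists h; split=> // E; have [_ hn _] := hH.
(* Evaluating the dual filter at the negations of [x] and [y] leads back to [P]. *)
have : ~ P (neg A (neg A y)) by rewrite negK.
by rewrite hP hn -E -hn -hP negK.
Qed.

Lemma gen_extension n k (A B : algebra n) (e : A -> B) (g : A -> gen n k) :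
  k <= n -> representable A -> representable B -> is_embedding e -> is_hom g ->
  exists h : B -> gen n k, is_hom h /\ forall a, h (e a) = g a.
Proof.
move=> kn Arep Brep; apply: reduced_extension => //.
- exact: gen_representable.
- exact: gen_filter_prime.
- exact: gen_filter_reduced.
Qed.

(** * Products and quotients *)

Lemma V_surj n (A B : algebra n) (h : A -> B) :
  is_hom h -> Defs.surjective h -> V A -> V B.
Proof.
move=> hH hS [C [g [KC gH gS]]]; exists C, (h \o g); split=> //.
  exact: comp_hom.
by move=> b; have [a <-] := hS b; have [c <-] := gS a; exists c.
Qed.

(** The product is the image of a power of J_n under the coordinatewise constant maps; [U] is the
    whole power, seen as a subalgebra. *)
Lemma V_prod_gen n (I : Type) (k : I -> nat) :
  (forall i, k i <= n) -> V (prod_alg (fun i => gen n (k i))).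
Proof.
move=> kn; pose P := prod_alg (fun _ : I => Jalg n).
pose U : subuniverse P :=
  @Subuniverse n P (fun=> True) (fun _ _ _ _ _ => Logic.I) (fun _ _ => Logic.I)
    (fun=> Logic.I).
exists (sub_alg U), (fun x i => cst (gen n (k i)) (sval x i)); split.
- exists P, U; split; last by exists id; split; [split | exists id].
  exists I, (fun=> Jalg n); split=> //.
  by exists id; split; [split | exists id].
- split=> [o x y|x|c] /=; apply: functional_extensionality_dep => i.
  + by have [E _ _] := cst_gen_hom (kn i); apply: E.
  + by have [_ E _] := cst_gen_hom (kn i); apply: E.
  + by [].
- move=> x; have [f fE] := choice (fun i => cst_gen_surj (kn i) (x i)).
  exists (exist _ f Logic.I); apply: functional_extensionality_dep => i.
  exact: fE.
Qed.

Lemma V_gen n k : k <= n -> V (gen n k).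
Proof.
move=> kn; have VP := @V_prod_gen n unit (fun=> k) (fun=> kn).
pose pi (x : prod_alg (fun _ : unit => gen n k)) : gen n k := x tt.
have piH : is_hom pi by [].
by apply: V_surj piH _ VP => x; exists (fun=> x).
Qed.

Lemma injective_gen n k : k <= n -> injective_in (@V n) (gen n k).
Proof.
move=> kn; split; first exact: V_gen.
by move=> A B e g /V_representable Ar /V_representable Br; apply: gen_extension.
Qed.

Lemma injective_prod n (I : Type) (C : I -> algebra n) :
  V (prod_alg C) -> (forall i, injective_in (@V n) (C i)) ->
  injective_in (@V n) (prod_alg C).
Proof.
move=> VC Cinj; split=> // A B e g VA VB eE [gb gn gc].
have ext i : exists h : B -> C i, is_hom h /\ forall a, h (e a) = g a i.
  have [_] := Cinj i; apply=> //.
  by split=> [o x y|x|c]; rewrite ?gb ?gn ?gc.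
exists (fun b i => sval (cid (ext i)) b); split.
  split=> [o x y|x|c]; apply: functional_extensionality_dep => i /=;
    by have [[hb hn hc] _] := svalP (cid (ext i)).
move=> a; apply: functional_extensionality_dep => i.
by have [_ hE] := svalP (cid (ext i)); apply: hE.
Qed.

Definition gen_homs n (A : algebra n) : Type :=
  {k : 'I_n.+1 & {h : A -> gen n k | is_hom h}}.

Definition gen_eval n (A : algebra n) (a : A) :
    prod_alg (fun i : gen_homs A => gen n (projT1 i)) :=
  fun i => proj1_sig (projT2 i) a.

Lemma gen_eval_embedding n (A : algebra n) :
  representable A -> is_embedding (@gen_eval n A).
Proof.
move=> Arep; split.
  split=> [o x y|x|c]; apply: functional_extensionality_dep => i;
    by rewrite /gen_eval /=; case: i => /= k [h [hb hn hc]] /=.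
move=> x y xy; apply: contrapT => nxy.
have [k [h [hH]]] := gen_separation Arep nxy; apply.
pose i : gen_homs A := existT _ k (exist _ h hH).
by rewrite -[h x]/(gen_eval x i) xy.
Qed.

Lemma quotient_algebra n (A : algebra n) (R : A -> A -> Prop) :
  is_congruence R -> exists (Q : algebra n) (pi : A -> Q),
    [/\ is_hom pi, Defs.surjective pi & forall x y, pi x = pi y <-> R x y].
Proof.
move=> [[Rr Rs Rt] [Rb Rn]].
pose Q := {X : A -> Prop | exists x, X = R x}.
pose pi x : Q := exist _ (R x) (ex_intro _ x erefl).
have piE x y : pi x = pi y <-> R x y.
  split=> [[->]//|xy]; apply: eq_exist; apply: funext => z; apply: propext.
  by split=> ?; [apply: Rt (Rs _ _ xy) _ | apply: Rt xy _].
have piS : Defs.surjective pi by move=> [X [x XE]]; exists x; apply: eq_exist.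
have [r rK] := choice piS.
exists (Algebra (fun o X Y => pi (bin A o (r X) (r Y)))
  (fun X => pi (neg A (r X))) (fun c => pi (cst A c))), pi; split=> //.
split=> [o x y|x|c] //=; apply/piE.
  by apply: Rb; apply/piE; rewrite rK.
by apply: Rn; apply/piE; rewrite rK.
Qed.

(** * Subdirectly irreducible algebras *)

(** The pair [p], [q] generates the least nontrivial congruence: a term [s] sends the filter to [q]
    and its complement to [p]. Distinct [x], [y] are told apart by some term [t] with respect to the
    filter, so identifying them identifies [p] and [q]. *)
Lemma gen_monolith n k : k <= n -> exists p q : gen n k, p <> q /\
  forall (B : algebra n) (h : gen n k -> B),
    is_hom h -> h p <> h q -> injective h.
Proof.
move=> kn; have [p [q [s [pq sq sp]]]] : exists (p q : gen n k) (s : term n),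
    [/\ p <> q, forall x : gen n k, gen_filter k x -> eval (fun=> x) s = q &
        forall x : gen n k, ~ gen_filter k x -> eval (fun=> x) s = p].
  case: k kn => [|k] kn.
    (* Joining with bot sends top and t_0 to t_0, and bot and f_0 to bot. *)
    exists (Jbot : J 0), (Jt ord0), (TBin Vee (TVar true) (TCst Jbot)).
    split=> //; first by case=> //= *; congr Jt; apply: ord1.
    by case=> // [|i] /(_ isT).
  (* Meeting with f fixes 0 and sends every other element to f. *)
  exists (Jf ord0 : J 1), (Jf ord_max),
    (TBin Wedge (TVar true) (TCst (Jf ord_max))).
  have nk : (n < k.+1) = false by rewrite ltnNge kn.
  split=> //; case=> [||i|i] /=; rewrite ?nk //.
    by have [->|->] := ord2P i; rewrite ?minxx.
  by have [->|->] := ord2P i; rewrite ?ordE // => /(_ isT).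
exists p, q; split=> // B h hH hpq x y hxy.
apply: (@gen_filter_reduced n k) => t.
have eval_s z : h (eval (fun=> eval (fun=> z) t) s) =
    eval (fun=> eval (fun=> h z) t) s.
  by rewrite eval_hom //; congr eval; apply: funext => b /=; rewrite eval_hom.
have same : h (eval (fun=> eval (fun=> x) t) s) =
    h (eval (fun=> eval (fun=> y) t) s) by rewrite !eval_s hxy.
by split=> H; apply: contrapT => H'; apply: hpq; move: same;
  rewrite (sq _ H) (sp _ H').
Qed.

Lemma gen_subdirectly_irreducible n k :
  k <= n -> subdirectly_irreducible (gen n k).
Proof.
move=> kn I B h [[hb hn hc] hI] hS; have [p [q [pq mono]]] := gen_monolith kn.
have [i hi] : exists i, h p i <> h q i.
  apply/existsNP => E; apply/pq/hI; exact: functional_extensionality_dep.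
have hiH : is_hom (fun a => h a i) by split=> *; rewrite ?hb ?hn ?hc.
by exists i; split=> //; apply: inj_surj_bij (hS i); apply: mono hiH hi.
Qed.

(** The embedding [gen_eval] is subdirect, as every homomorphism into [gen n k] with k at most n is
    onto. *)
Lemma subdirectly_irreducible_gen n (A : algebra n) :
  representable A -> subdirectly_irreducible A ->
  exists2 k, k <= n & isomorphic A (gen n k).
Proof.
move=> Arep /(_ _ _ _ (gen_eval_embedding Arep))[|[k [h hH]] /= hiso].
  by move=> [k [h hH]]; apply: (hom_gen_surj _ hH); apply: leq_ord.
by exists k; [apply: leq_ord | exists h].
Qed.

Lemma isomorphic_sym n (A B : algebra n) : isomorphic A B -> isomorphic B A.
Proof.
move=> [h [hH [g hK gK]]]; exists g; split; first exact: inverse_hom hH hK gK.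
by exists h.
Qed.

Lemma isomorphic_trans n (A B C : algebra n) :
  isomorphic A B -> isomorphic B C -> isomorphic A C.
Proof.
move=> [g [gH gB]] [h [hH hB]]; exists (h \o g); split; first exact: comp_hom.
exact: bij_comp.
Qed.

Lemma isomorphic_V n (A B : algebra n) : isomorphic A B -> V A -> V B.
Proof. by move=> [h [hH [g _ gK]]]; apply: V_surj hH _ => b; exists (g b). Qed.

Lemma isomorphic_subdirectly_irreducible n (A B : algebra n) :
  isomorphic A B -> subdirectly_irreducible A -> subdirectly_irreducible B.
Proof.
move=> [g [gH [f gK fK]]] Asi I C h [[hb hn hc] hI] hS.
have [gb gn gc] := gH.
have [| |i [[ib in_ ic] iB]] := Asi I C (h \o g).
- split; last by move=> x y /= /hI /(can_inj gK).
  by apply: comp_hom.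
- by move=> i c; have [b <-] := hS i c; exists (f b); rewrite /= fK.
exists i; split; first by split=> *; rewrite ?hb ?hn ?hc.
apply: (eq_bij (bij_comp iB (Bijective fK gK))) => b /=.
by rewrite fK.
Qed.

(** * Non-isomorphism and cardinalities *)

Lemma isomorphic_cst n (A B : algebra n) c d :
  isomorphic A B -> cst A c = cst A d <-> cst B c = cst B d.
Proof.
by move=> [h [[_ _ hc] /bij_inj hI]]; rewrite -!hc; split=> [->|/hI].
Qed.

(** If l < k, the constants f_l and f_n coincide in J_{1,n,l} but not in J_{1,n,k}. *)
Lemma isomorphic_J1 n k l : k <= n -> l <= n ->
  isomorphic (J1alg n k) (J1alg n l) -> k <= l.
Proof.
move=> kn ln iso; rewrite leqNgt; apply/negP => lk.
have := isomorphic_cst (Jf (inord l)) (Jf ord_max) iso.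
by rewrite /= !inordK // lk ltnn !ltnNge kn ln => -[_ /(_ erefl)].
Qed.

Lemma isomorphic_J01 n k : 0 < k <= n -> ~ isomorphic (J0alg n) (J1alg n k).
Proof.
move=> /andP[k0 kn] /(isomorphic_cst (Jf ord0) (Jf ord_max)) /=.
by rewrite k0 ltnNge kn => -[/(_ erefl)].
Qed.

Lemma card_J_bij n m : m = n.*2 + 4 -> has_card m (J n).
Proof.
by move=> ->; rewrite -card_J; exists enum_rank; apply: enum_rank_bij.
Qed.

Lemma Jalg0_gen : isomorphic (Jalg 0) (gen 0 0).
Proof.
exists id; split; last by exists id.
by split=> // -[||i|i] //=; rewrite (ord1 i).
Qed.

(** * Congruence extension and amalgamation *)

(** The extension is the common kernel of all homomorphisms from [A] to some [gen n k] that respect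
    [R] on [S]. A pair outside [R] is separated by a homomorphism from the quotient of [S], which
    extends to [A] by injectivity. *)
Lemma V_congruence_extension n : congruence_extension_property (@V n).
Proof.
move=> A S R /V_representable Arep Rcong.
have Srep := representable_sub S Arep.
have [Q [pi [piH piS piE]]] := quotient_algebra Rcong.
have Qrep := representable_surj piH piS Srep.
pose compat k (h : A -> gen n k) :=
  is_hom h /\ forall x y : sub_alg S, R x y -> h (sval x) = h (sval y).
exists (fun a b =>
  forall (k : 'I_n.+1) (h : A -> gen n k), compat _ h -> h a = h b).
  split; last split.
  - by split=> [//|x y H k h hc|x y z H1 H2 k h hc]; rewrite ?H // H1 ?H2.
  - by move=> o x x' y y' H1 H2 k h hc; have [[hb _ _] _] := hc;
      rewrite !hb (H1 k h) ?(H2 k h).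
  - by move=> x x' H k h hc; have [[_ hn _] _] := hc; rewrite !hn (H k h).
move=> x y; split=> [Rxy k h [_]|H]; first exact.
apply: contrapT => nR.
have [|k [h [hH hxy]]] := gen_separation (x := pi x) (y := pi y) Qrep.
  by move=> /piE.
have incl : is_embedding (@proj1_sig A S : sub_alg S -> A).
  by split; [apply: sub_incl_hom | apply: sval_inj].
have [g [gH gE]] := gen_extension (leq_ord k) Srep Arep incl (comp_hom piH hH).
apply: hxy; have := gE x; have := gE y; rewrite /= => <- <-; apply: H.
by split=> // u v /piE uv; rewrite !gE /= uv.
Qed.

(** The amalgam is the product over all pairs of homomorphisms from [B] and [C] to a common
    [gen n k] that agree on [A]. By injectivity, a homomorphism separating points on one side is
    part of such a pair. *)
Lemma V_amalgamation n : amalgamation_property (@V n).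
Proof.
move=> A B C f g /V_representable Ar /V_representable Br /V_representable Cr.
move=> fE gE.
pose cone k (hh : (B -> gen n k) * (C -> gen n k)) :=
  [/\ is_hom hh.1, is_hom hh.2 & forall a, hh.1 (f a) = hh.2 (g a)].
pose I := {k : 'I_n.+1 & {hh : (B -> gen n k) * (C -> gen n k) | cone k hh}}.
pose D := prod_alg (fun i : I => gen n (projT1 i)).
pose f' (b : B) : D := fun i => (sval (projT2 i)).1 b.
pose g' (c : C) : D := fun i => (sval (projT2 i)).2 c.
exists D, f', g'; split.
- by apply: V_prod_gen => i; apply: leq_ord.
- split.
    split=> [o x y|x|c]; apply: functional_extensionality_dep => i;
      by rewrite /f' /=; case: i => /= k [[h h'] /= [[hb hn hc] _ _]].
  move=> x y xy; apply: contrapT => nxy.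
  have [k [h [hH hxy]]] := gen_separation Br nxy.
  have [h' [h'H h'E]] := gen_extension (leq_ord k) Ar Cr gE (comp_hom fE.1 hH).
  have hh : cone k (h, h') by split=> // a; rewrite h'E.
  exact: hxy (congr1 (fun u : D => u (existT _ k (exist _ _ hh))) xy).
- split.
    split=> [o x y|x|c]; apply: functional_extensionality_dep => i;
      by rewrite /g' /=; case: i => /= k [[h h'] /= [_ [hb hn hc] _]].
  move=> x y xy; apply: contrapT => nxy.
  have [k [h [hH hxy]]] := gen_separation Cr nxy.
  have [h' [h'H h'E]] := gen_extension (leq_ord k) Ar Br fE (comp_hom gE.1 hH).
  have hh : cone k (h', h) by split=> // a; rewrite /= h'E.
  exact: hxy (congr1 (fun u : D => u (existT _ k (exist _ _ hh))) xy).
- move=> a; apply: functional_extensionality_dep => i.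
  by rewrite /f' /g' /=; case: i => k [[h h'] /= [_ _ E]] /=.
Qed.

Theorem proposition2p6 :
  (forall A : algebra 0,
     V A /\ subdirectly_irreducible A <-> isomorphic A (Jalg 0)) /\
  (forall n : nat, 0 < n ->
     [/\ V (J0alg n) /\ subdirectly_irreducible (J0alg n),
         forall k : nat, 1 <= k <= n ->
           V (J1alg n k) /\ subdirectly_irreducible (J1alg n k),
         forall A : algebra n, V A -> subdirectly_irreducible A ->
           isomorphic A (J0alg n) \/
           exists2 k : nat, 1 <= k <= n & isomorphic A (J1alg n k)
       & [/\ has_card 4 (J0alg n),
             forall k : nat, 1 <= k <= n -> has_card 6 (J1alg n k),
             forall k : nat, 1 <= k <= n -> ~ isomorphic (J0alg n) (J1alg n k)
           & forall k l : nat, 1 <= k <= n -> 1 <= l <= n ->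
               isomorphic (J1alg n k) (J1alg n l) -> k = l]]) /\
  (forall n : nat,
     [/\ injective_in (@V n) (J0alg n) /\
           (forall k : nat, 1 <= k <= n -> injective_in (@V n) (J1alg n k)),
         forall A : algebra n, V A ->
           exists C : algebra n, injective_in (@V n) C /\
             exists e : A -> C, is_embedding e
       & congruence_extension_property (@V n) /\
         amalgamation_property (@V n)]).
Proof.
have J1E n k : 0 < k -> J1alg n k = gen n k by case: k.
split; [|split].
- move=> A; split=> [[/V_representable Ar Asi]|iso].
    have [k k0 Ak] := subdirectly_irreducible_gen Ar Asi.
    apply: isomorphic_trans Ak (isomorphic_sym _).
    by move: k0; rewrite leqn0 => /eqP->; apply: Jalg0_gen.
  have {}iso := isomorphic_sym (isomorphic_trans iso Jalg0_gen).
  split; first exact: isomorphic_V iso (V_gen _).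
  exact: isomorphic_subdirectly_irreducible iso (gen_subdirectly_irreducible _).
- move=> n n0; split.
  + by split; [apply: (@V_gen n 0) | apply: (@gen_subdirectly_irreducible n 0)].
  + move=> k /andP[k0 kn]; rewrite J1E //.
    by split; [apply: V_gen | apply: gen_subdirectly_irreducible].
  + move=> A /V_representable Ar Asi.
    have [[|k] kn Ak] := subdirectly_irreducible_gen Ar Asi; [by left | right].
    by exists k.+1.
  + split; [exact: card_J_bij | by move=> k _; apply: card_J_bij | |].
      by move=> k; apply: isomorphic_J01.
    move=> k l /andP[_ kn] /andP[_ ln] iso; apply/eqP; rewrite eqn_leq.
    by rewrite !(isomorphic_J1 _ _ iso, isomorphic_J1 _ _ (isomorphic_sym iso)).
- move=> n; split.
  + split; first exact: (@injective_gen n 0).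
    by move=> k /andP[k0 kn]; rewrite J1E //; apply: injective_gen.
  + move=> A /V_representable Ar.
    exists (prod_alg (fun i : gen_homs A => gen n (projT1 i))); split.
      apply: injective_prod; first by apply: V_prod_gen => i; apply: leq_ord.
      by move=> i; apply: injective_gen; apply: leq_ord.
    by exists (@gen_eval n A); apply: gen_eval_embedding.
  + by split; [apply: V_congruence_extension | apply: V_amalgamation].
Qed.
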